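(* Let $(\mathscr{G},\omega)$ be a Cartan geometry of type $(G,H)$ and $\mathscr{e}\in\mathscr{G}$. Suppose $(\gamma_k)$ is a sequence in $\mathrm{Path}_{\mathscr{e}}(\mathscr{G})$. If $(\gamma_k)$ converges in $\mathrm{Path}_{\mathscr{e}}(\mathscr{G})$ (with respect to the first-order compact-open topology) to the constant path at $\mathscr{e}$, then the developments $(\gamma_k)_G(1)$ converge to the identity element $e\in G$.
   Context: A model $(G,H)$ is a Lie group $G$ with a closed subgroup $H$ such that $G/H$ is connected; $e\in G$ is the identity and $\omega_G$ is the (left-invariant) Maurer--Cartan form. A Cartan geometry of type $(G,H)$ over a smooth manifold $M$ is a principal (right) $H$-bundle $\mathscr{G}\to M$ with a $\mathfrak{g}$-valued one-form $\omega$ such that each $\omega_{\mathscr{g}}\colon T_{\mathscr{g}}\mathscr{G}\to\mathfrak{g}$ is a linear isomorphism, $R_h^*\omega=\mathrm{Ad}_{h^{-1}}\omega$ for $h\in H$, and for $Y\in\mathfrak{h}$ the flow of $\omega^{-1}(Y)$ is $t\mapsto R_{\exp(tY)}$. ''Path'' means piecewise smooth path. $\mathrm{Path}_{\mathscr{e}}(\mathscr{G})$ is the set of paths $\gamma\colon[0,1]\to\mathscr{G}$ with $\gamma(0)=\mathscr{e}$. The development of $\gamma$ is the unique path $\gamma_G\colon[0,1]\to G$ with $\gamma_G(0)=e$ and $\gamma^*\omega=\gamma_G^*\omega_G$. For an inner product $\mathrm{g}$ on $\mathfrak{g}$, the $\omega$-constant Riemannian metric on $\mathscr{G}$ is $\mathrm{g}_\omega(\xi_1,\xi_2)=\mathrm{g}(\omega(\xi_1),\omega(\xi_2))$.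 The first-order compact-open topology on $\mathrm{Path}_{\mathscr{e}}(\mathscr{G})$ is the one induced by the metric $$d_{\mathrm{g}_\omega}(\gamma_1,\gamma_2)=\sup_{t\in[0,1]}\mathrm{dist}_{\mathrm{g}_\omega}(\gamma_1(t),\gamma_2(t))+\sup_{t}\|\omega(\dot\gamma_1(t))-\omega(\dot\gamma_2(t))\|_{\mathrm{g}},$$ the second supremum being over all $t\in[0,1]$ at which both derivatives are well defined; the choice of $\mathrm{g}$ is arbitrary. *)

(* Defs.v *)
From HB Require Import structures.
From mathcomp Require Import all_boot all_order all_algebra.
From mathcomp Require Import all_classical all_reals all_analysis.
Import Order.TTheory GRing.Theory Num.Theory.
Import numFieldNormedType.Exports.

Set Implicit Arguments.
Unset Strict Implicit.
Unset Printing Implicit Defensive.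

Local Open Scope classical_set_scope.
Local Open Scope ring_scope.
Local Open Scope quotient_scope.

(* For finite-dimensional [V] (the only case used) this is the usual class C^k
   on the open set [U]: [f] is C^(k+1) iff it is differentiable and all its
   directional derivatives are C^k. *)
Fixpoint Ck (R : realType) (V W : normedModType R) (k : nat) (U : set V)
    (f : V -> W) : Prop :=
  if k is k'.+1 then
    (forall x, U x -> differentiable f x) /\
    (forall v, Ck k' U (fun x => 'd f x v))
  else forall x, U x -> {for x, continuous f}.

Definition smooth_on (R : realType) (V W : normedModType R) (U : set V)
    (f : V -> W) : Prop :=
  forall k, Ck k U f.

(* A homeomorphism from an open subset of [M] onto an open subset of R^n. The
   two underlying functions are total; their values outside [chart_dom] and
   [chart_cod] are irrelevant. *)
Record chart (R : realType) (n : nat) (M : topologicalType) := Chart {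
  chart_dom : set M ;
  chart_fun :> M -> 'rV[R]_n ;
  chart_inv : 'rV[R]_n -> M ;
  chart_dom_open : open chart_dom ;
  chart_cod_open : open (chart_fun @` chart_dom) ;
  chart_funK : forall p, chart_dom p -> chart_inv (chart_fun p) = p ;
  chart_fun_continuous : forall p, chart_dom p -> {for p, continuous chart_fun} ;
  chart_inv_continuous : forall x, (chart_fun @` chart_dom) x ->
    {for x, continuous chart_inv}
}.

Definition chart_cod (R : realType) (n : nat) (M : topologicalType)
    (c : chart R n M) : set 'rV[R]_n :=
  c @` chart_dom c.

(* [chart_at p] is a preferred chart of the atlas around [p]. It is only used
   to represent tangent vectors at [p] and smoothness at [p], neither of which
   depends on this choice up to the canonical identifications. *)
HB.mixin Record isManifold (R : realType) (n : nat) M of Topological M := {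
  atlas : set (chart R n M) ;
  chart_at : M -> chart R n M ;
  chart_at_atlas : forall p, atlas (chart_at p) ;
  chart_at_dom : forall p, chart_dom (chart_at p) p ;
  atlas_smooth : forall c d, atlas c -> atlas d ->
    smooth_on (c @` (chart_dom c `&` chart_dom d)) (d \o chart_inv c) ;
  manifold_hausdorff : hausdorff_space M ;
  manifold_second_countable : @second_countable M
}.

#[short(type="manifoldType")]
HB.structure Definition Manifold (R : realType) (n : nat) :=
  {M of Topological M & isManifold R n M}.

(* The tangent space at [p] is R^n, a vector being represented by its
   coordinates in the preferred chart at [p]. *)
Definition tangent (R : realType) (n : nat) (M : manifoldType R n) (p : M) :
  normedModType R := 'rV[R]_n.

Definition mderiv (R : realType) (m n : nat) (M : manifoldType R m)
    (N : manifoldType R n) (F : M -> N) (p : M) : tangent p -> tangent (F p) :=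
  'd (chart_at (F p) \o F \o chart_inv (chart_at p)) (chart_at p p).
Arguments mderiv {R m n M N} F p v.

Section SmoothMaps.
Context (R : realType).

Definition smooth_at (V : normedModType R) (n : nat) (N : manifoldType R n)
    (F : V -> N) (x : V) : Prop :=
  exists U : set V, [/\ open U, U x, F @` U `<=` chart_dom (chart_at (F x))
    & smooth_on U (chart_at (F x) \o F)].

(* Smoothness of the restriction of [F] to an arbitrary subset [A], in the
   sense of local extendability to a smooth map. *)
Definition smooth_within (V : normedModType R) (n : nat) (N : manifoldType R n)
    (A : set V) (F : V -> N) (x : V) : Prop :=
  exists2 F' : V -> N, smooth_at F' x & \forall y \near x, A y -> F' y = F y.

Definition smooth_map (m n : nat) (M : manifoldType R m) (N : manifoldType R n)
    (A : set M) (F : M -> N) : Prop :=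
  forall p, A p -> let c := chart_at p in
    smooth_within (chart_inv c @^-1` A) (F \o chart_inv c) (c p).

(* Smoothness on [A `*` B] in the product manifold, whose charts are the
   products of charts of the factors. *)
Definition smooth_map2 (l m n : nat) (L : manifoldType R l)
    (M : manifoldType R m) (N : manifoldType R n)
    (A : set L) (B : set M) (F : L -> M -> N) : Prop :=
  forall p q, A p -> B q -> let c := chart_at p in let d := chart_at q in
    smooth_within ((chart_inv c @^-1` A) `*` (chart_inv d @^-1` B))
      (fun z : 'rV[R]_l * 'rV[R]_m => F (chart_inv c z.1) (chart_inv d z.2))
      (c p, d q).

End SmoothMaps.

Section Curves.
Context (R : realType) (n : nat) (M : manifoldType R n).

(* [v] is the velocity at [t] of the curve [gamma], restricted to times in [D];
   it is one-sided when [t] is an end point of the interval [D]. *)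
Definition is_velocity (D : set R) (gamma : R -> M) (t : R)
    (v : tangent (gamma t)) : Prop :=
  gamma @ within D (nbhs t) --> gamma t /\
  (fun s => (s - t)^-1 *:
     (chart_at (gamma t) (gamma s) - chart_at (gamma t) (gamma t)))
    @ within D (dnbhs t) --> (v : 'rV[R]_n).
Arguments is_velocity : clear implicits.

Definition has_velocity (D : set R) (gamma : R -> M) (t : R) : Prop :=
  exists v, is_velocity D gamma t v.

Definition velocity (D : set R) (gamma : R -> M) (t : R) : tangent (gamma t) :=
  xget 0 [set v | is_velocity D gamma t v].

(* A path [0,1] -> M is given by a function on [R], of which only the
   values on [0,1] matter. *)
Definition is_path (gamma : R -> M) : Prop :=
  exists (k : nat) (t : nat -> R), [/\ t 0%N = 0, t k = 1 &
    forall i, (i < k)%N -> t i < t i.+1 /\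
      forall s, s \in `[t i, t i.+1] ->
        smooth_within (V := R^o) [set` `[t i, t i.+1]] gamma s].

Definition path_from (p : M) (gamma : R -> M) : Prop :=
  is_path gamma /\ gamma 0 = p.

Definition is_flow (X : forall p : M, tangent p) (Phi : R -> M -> M) : Prop :=
  (forall p, Phi 0 p = p) /\
  (forall p t, is_velocity setT (fun s => Phi s p) t (X (Phi t p))).

End Curves.
Arguments is_velocity {R n M} D gamma t v.

HB.mixin Record isLieGroup (R : realType) (n : nat) G
    of Manifold R n G & Group G := {
  mulg_smooth : smooth_map2 [set: G] [set: G] (fun x y : G => (x * y)%g) ;
  invg_smooth : smooth_map [set: G] (fun x : G => (x^-1)%g)
}.

#[short(type="lieGroupType")]
HB.structure Definition LieGroup (R : realType) (n : nat) :=
  {G of Manifold R n G & Group G & isLieGroup R n G}.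

Section LieGroups.
Context (R : realType) (n : nat) (G : lieGroupType R n).

Definition lie_algebra : normedModType R := tangent (1%g : G).

Definition maurer_cartan (x : G) : tangent x -> lie_algebra :=
  mderiv (fun y : G => (x^-1 * y)%g) x.

Definition Ad (x : G) : lie_algebra -> lie_algebra :=
  mderiv (fun y : G => (x * y * x^-1)%g) 1%g.

Definition one_parameter_subgroup (Y : lie_algebra) (c : R -> G) : Prop :=
  [/\ forall s t, c (s + t) = (c s * c t)%g,
      forall t, smooth_at (V := R^o) c t & is_velocity setT c 0 Y].

(* exp(Y) = c(1) for the one-parameter subgroup [c] with initial velocity [Y],
   which exists and is unique; the default value of [xget] is never used. *)
Definition lie_exp (Y : lie_algebra) : G :=
  xget (fun=> 1%g) (one_parameter_subgroup Y) 1.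

Record closedSubgroup := ClosedSubgroup {
  subgroup_set :> set G ;
  subgroup_closed : closed subgroup_set ;
  subgroup_group : group_closed (mem subgroup_set)
}.

(* The Lie algebra of the embedded Lie subgroup [H]. *)
Definition lie_subalgebra (H : closedSubgroup) : set lie_algebra :=
  [set Y | forall t : R, subgroup_set H (lie_exp (t *: Y))].

Section CosetSpace.
Variable H : closedSubgroup.

Definition coset_rel (x y : G) : bool := `[< subgroup_set H (x^-1 * y)%g >].

Lemma coset_rel_equiv : equiv_class_of coset_rel.
Proof.
have [H1 HV] := subgroup_group H.
have HN := group_closedV (conj H1 HV); have HM := group_closedM (conj H1 HV).
split=> [x|x y|y x z].
- by apply/asboolP; rewrite mulVg; exact: set_mem H1.
- by apply/asboolP/asboolP => /mem_set/HN/set_mem; rewrite invgM invgK.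
- move=> /asboolP xy /asboolP yz; apply/asboolP.
  have /set_mem := HM _ _ (mem_set xy) (mem_set yz).
  by rewrite mulgA mulgK.
Qed.

Canonical coset_equiv := EquivRelPack coset_rel_equiv.

Definition coset_space : topologicalType :=
  quotient_topology {eq_quot coset_equiv}.

End CosetSpace.

End LieGroups.
Arguments maurer_cartan {R n G} x v.
Arguments Ad {R n G} x v.

Section Cartan.
Context (R : realType) (n : nat) (G : lieGroupType R n) (H : closedSubgroup G).

(* [ract u h] is only meaningful for [h] in [H]. Over [U], the map
   (x, h) |-> s(x)h is a diffeomorphism from U * H onto the preimage of U, with
   inverse (proj, tau). *)
Record principalBundle (m l : nat) (M : manifoldType R m)
    (P : manifoldType R l) := PrincipalBundle {
  proj : P -> M ;
  ract : P -> G -> P ;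
  proj_smooth : smooth_map [set: P] proj ;
  ract_smooth : smooth_map2 [set: P] H ract ;
  ract1 : forall u, ract u 1%g = u ;
  ractM : forall u h k, subgroup_set H h -> subgroup_set H k ->
    ract u (h * k)%g = ract (ract u h) k ;
  locally_trivial : forall x : M, exists (U : set M) (s : M -> P) (tau : P -> G),
    [/\ open U /\ U x,
        smooth_map U s,
        smooth_map (proj @^-1` U) tau,
        forall y h, U y -> subgroup_set H h ->
           proj (ract (s y) h) = y /\ tau (ract (s y) h) = h
      & forall u, U (proj u) ->
          subgroup_set H (tau u) /\ ract (s (proj u)) (tau u) = u]
}.

(* The coordinate expressions of the g-valued 1-form are smooth. *)
Definition smooth_form (l : nat) (P : manifoldType R l)
    (omega : forall u : P, tangent u -> lie_algebra G) : Prop :=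
  forall c : chart R l P, atlas c -> forall v : 'rV[R]_l,
    smooth_on (chart_cod c) (fun x => let u := chart_inv c x in
      omega u ('d (chart_at u \o chart_inv c) x v)).

Record cartanGeometry (m l : nat) (M : manifoldType R m)
    (P : manifoldType R l) := CartanGeometry {
  cartan_bundle :> principalBundle M P ;
  omega : forall u : P, {linear tangent u -> lie_algebra G} ;
  omega_smooth : smooth_form omega ;
  omega_bij : forall u, bijective (omega u) ;
  omega_equivariant : forall h, subgroup_set H h -> forall u (v : tangent u),
    omega (ract cartan_bundle u h) (mderiv ((ract cartan_bundle)^~ h) u v) =
    Ad (h^-1)%g (omega u v) ;
  omega_flow : forall Y, lie_subalgebra H Y ->
    forall X : (forall u : P, tangent u), (forall u, omega u (X u) = Y) ->
    is_flow X (fun t u => ract cartan_bundle u (lie_exp (t *: Y)))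
}.

Context (m l : nat) (M : manifoldType R m) (P : manifoldType R l).
Variable C : cartanGeometry M P.

Local Notation I := [set` `[0 : R, 1]].

(* The second clause is the equality of the pullbacks of the two forms. *)
Definition is_development (gamma : R -> P) (gammaG : R -> G) : Prop :=
  path_from 1%g gammaG /\
  forall t, I t -> forall v w, is_velocity I gamma t v ->
    is_velocity I gammaG t w -> omega C (gamma t) v = maurer_cartan (gammaG t) w.

Variable g : {dot (lie_algebra G) for idfun}.

Definition lie_norm (Y : lie_algebra G) : R := Num.sqrt (g Y Y).

Definition omega_metric (u : P) (v w : tangent u) : R :=
  g (omega C u v) (omega C u w).

Local Open Scope ereal_scope.

Definition path_length (gamma : R -> P) : \bar R :=
  \int[lebesgue_measure]_(t in I)
    (Num.sqrt (omega_metric (velocity I gamma t) (velocity I gamma t)))%:E.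

Definition riemannian_dist (p q : P) : \bar R :=
  ereal_inf [set path_length gamma |
    gamma in [set gamma | path_from p gamma /\ gamma 1%R = q]].

(* The metric of the first-order compact-open topology. Taking values in the
   extended reals lets [riemannian_dist] be defined between distinct
   components; on paths with a common initial point it is finite. *)
Definition path_dist (gamma1 gamma2 : R -> P) : \bar R :=
  ereal_sup [set riemannian_dist (gamma1 t) (gamma2 t) | t in I] +
  ereal_sup [set (lie_norm (omega C (gamma1 t) (velocity I gamma1 t) -
                            omega C (gamma2 t) (velocity I gamma2 t)))%:E
    | t in I `&` has_velocity I gamma1 `&` has_velocity I gamma2].

End Cartan.

(* Main.v *)
(** Since the constant path has velocity zero, [path_dist] bounds the
    [omega]-speed of [gamma k], hence the left-invariant speed of its
    development, at all but finitely many times. In the preferred chart at 1 the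
    velocity of a curve near 1 is at most a constant times its Maurer-Cartan
    image, because left translations near 1 have bounded differentials at 1. A
    curve that starts at 1 with small speed in this sense cannot leave a small
    chart ball, and by the mean value inequality it ends close to 1. *)

Require Import Defs.
From HB Require Import structures.
From mathcomp Require Import all_boot all_order all_algebra.
From mathcomp Require Import all_classical all_reals all_analysis.
Import Order.TTheory GRing.Theory Num.Theory.
Import numFieldNormedType.Exports.
Local Open Scope classical_set_scope.
Local Open Scope ring_scope.

Set Implicit Arguments.
Unset Strict Implicit.
Unset Printing Implicit Defensive.

(** * Differentials of germs and smooth maps in charts *)

(** A first-order expansion depends only on the germ, so [f'] inherits that of [f], and the linear
    part of an expansion is unique. *)
Lemma near_eq_is_diff (R : numFieldType) (V W : normedModType R)
    (f f' : V -> W) (x : V) :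
  (\forall y \near x, f y = f' y) -> differentiable f x ->
  differentiable f' x /\ 'd f' x = 'd f x :> (V -> W).
Proof.
move=> ff' df.
have fx := nbhs_singleton ff'.
have exp : f' \o shift x = cst (f' x) + 'd f x +o_ 0 id.
  apply/eqaddoP => e e0; have := diff_locally df.
  move=> /eqaddoP/(_ e e0) fe.
  move: ff'; rewrite (near_shift 0) subr0 => ff'.
  near=> h.
  rewrite !fctE -fx /=; have <- : f (h + x) = f' (h + x) by near: h.
  by near: h.
have dd := diff_unique (diff_continuous df) exp.
split => //; apply/diff_locallyP; rewrite dd; split => //.
exact: diff_continuous.
Unshelve. all: by end_near. Qed.

Lemma smooth_on_differentiable (R : realType) (V W : normedModType R)
    (U : set V) (f : V -> W) (x : V) :
  smooth_on U f -> U x -> differentiable f x.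
Proof. by move=> /(_ 1%N)[+ _]; exact. Qed.

Lemma smooth_on_diff_continuous (R : realType) (V W : normedModType R)
    (U : set V) (f : V -> W) (x v : V) :
  smooth_on U f -> U x -> {for x, continuous (fun y => 'd f y v)}.
Proof. by move=> /(_ 1%N)[_ /(_ v)]; exact. Qed.

Lemma chart_cod_fun (R : realType) (n : nat) (M : topologicalType)
    (c : chart R n M) (p : M) : chart_dom c p -> chart_cod c (c p).
Proof. by exists p. Qed.

(** Smoothness gives continuity only of the coordinate expression. Composing with [chart_inv]
    recovers [F], since [F] maps [U] into the chart domain. *)
Lemma smooth_at_continuous (R : realType) (V : normedModType R) (n : nat)
    (N : manifoldType R n) (F : V -> N) (x : V) :
  smooth_at F x -> {for x, continuous F}.
Proof.
move=> [U [Uo Ux Fdom Fs]]; set c := chart_at (F x).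
have cF : {for x, continuous (c \o F)}.
  exact/differentiable_continuous/(smooth_on_differentiable Fs Ux).
have cFx : chart_cod c (c (F x)) by apply/chart_cod_fun/Fdom; exists x.
have Fdomx y : U y -> chart_inv c (c (F y)) = F y.
  by move=> Uy; apply/chart_funK/Fdom; exists y.
have cvgF : (chart_inv c \o (c \o F)) y @[y --> x] --> F x.
  rewrite -[X in _ --> X]Fdomx//; apply: cvg_comp cF _.
  exact: chart_inv_continuous cFx.
apply: cvg_trans cvgF; apply: near_eq_cvg.
have : nbhs x U by exact: open_nbhs_nbhs.
by apply: filterS => y Uy /=; rewrite Fdomx.
Qed.

(** At an interior point the local extension agrees with [F] on a neighbourhood, hence near each
    point close to [x]. The C^1 regularity of the extension, including its differentials, thus
    passes to [F]. *)
Lemma smooth_within_interior (R : realType) (V : normedModType R) (n : nat)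
    (N : manifoldType R n) (A : set V) (F : V -> N) (x : V) :
  nbhs x A -> smooth_within A F x ->
  [/\ {for x, continuous F},
      \forall y \near x, differentiable (chart_at (F x) \o F) y &
      forall v, {for x, continuous (fun y => 'd (chart_at (F x) \o F) y v)}].
Proof.
move=> Ax [F' F's F'F].
have {F'F}FF' : \forall y \near x, F' y = F y.
  by near=> y; apply: (near F'F y) => //; near: y.
have Fx := nbhs_singleton FF'.
have F'c := smooth_at_continuous F's.
case: F's => U [Uo Ux _]; rewrite Fx => F's.
have near_diff : \forall y \near x,
    differentiable (chart_at (F x) \o F) y /\
    'd (chart_at (F x) \o F) y = 'd (chart_at (F x) \o F') y :> (V -> _).
  have FF'' := near_join FF'.
  have Unear : nbhs x U by exact: open_nbhs_nbhs.
  near=> y; apply: near_eq_is_diff.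
    have : \forall z \near y, F' z = F z by near: y.
    by apply: filterS => z /= ->.
  by apply: smooth_on_differentiable F's _; near: y.
split.
- apply: cvg_trans (_ : F' @ x --> F x); last by rewrite -Fx.
  exact: near_eq_cvg.
- by apply: filterS near_diff => y [].
- move=> v; have [_ /= E] := nbhs_singleton near_diff.
  suff : 'd (chart_at (F x) \o F) y v @[y --> x] -->
    'd (chart_at (F x) \o F) x v by [].
  have F'd : 'd (chart_at (F x) \o F') y v @[y --> x] -->
    'd (chart_at (F x) \o F') x v by exact: smooth_on_diff_continuous F's Ux.
  rewrite E; apply: cvg_trans F'd.
  apply: near_eq_cvg; apply: filterS near_diff => y [_ /(congr1 (@^~ v))].
  exact: esym.
Unshelve. all: by end_near. Qed.

(** * Mean value inequality and confinement to a chart ball *)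

(** The norm on row vectors is the sup norm, so the scalar mean value theorem in each coordinate
    gives the same constant [L]. *)
Lemma norm_mvt (R : realType) (n : nat) (f : R -> 'rV[R]_n) (a b L : R) :
  a <= b -> 0 <= L ->
  (forall t, t \in `]a, b[ -> exists2 v, is_derive t 1 f v & `|v| <= L) ->
  {within `[a, b], continuous f} -> `|f b - f a| <= L * (b - a).
Proof.
move=> ab L0 df fc; have L1 : 0 <= L * (b - a) by rewrite mulr_ge0// subr_ge0.
rewrite /Num.Def.normr/= mx_normrE; apply: bigmax_le => // -[i j] _ /=.
(* The bound on [d] is imposed at every [t], with 0 as value outside the open interval, so it covers
   whatever intermediate point the mean value theorem returns. *)
have fd t : exists d : R,
    (t \in `]a, b[ -> is_derive t 1 (fun s => f s i j) d) /\ `|d| <= L.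
  have [/df[v [dv vE] vL]|tab] := boolP (t \in `]a, b[); last first.
    by exists 0; rewrite normr0.
  exists (v i j); split=> [_|].
    split; first by have /derivable_mxP := dv; exact.
    by rewrite -vE derive_mx// mxE.
  apply: le_trans vL; rewrite [leRHS]/Num.Def.normr/= mx_normrE.
  exact: (le_bigmax _ _ (i, j)).
have [d dP] := choice fd.
have fc' : {within `[a, b], continuous (fun s => f s i j)}.
  apply/subspace_continuousP => x xab.
  have fx : f s @[s --> within `[a, b] (nbhs x)] --> f x.
    exact: (subspace_continuousP _ _).1 fc x xab.
  have := @cvg_comp _ _ _ f (fun M : 'rV[R]_n => M i j) _ _ _ fx.
  by apply; exact: coord_continuous.
have [|c _] := @MVT_segment R (fun s => f s i j) d a b ab _ fc'.
  by move=> x xab; apply: (dP x).1.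
rewrite !mxE => ->; rewrite normrM [X in _ * X]ger0_norm ?subr_ge0//.
by rewrite ler_wpM2r ?subr_ge0//; exact: (dP c).2.
Qed.

(** The set is the image of a compact ball of R^n under [chart_inv], hence compact, hence closed in
    the Hausdorff space [M]. A limit of points of the ball therefore cannot fall outside the chart
    domain. *)
Lemma chart_closed_ball (R : realType) (n : nat) (M : topologicalType)
    (c : chart R n M) (x : 'rV[R]_n) (r : R) :
  hausdorff_space M -> (forall y, `|y - x| <= r -> chart_cod c y) ->
  closed [set p | chart_dom c p /\ `|c p - x| <= r].
Proof.
move=> hM cr; suff -> : [set p | chart_dom c p /\ `|c p - x| <= r] =
    chart_inv c @` [set y | `|y - x| <= r].
  apply: compact_closed => //; apply: continuous_compact.
    apply: continuous_in_subspaceT => y /set_mem/cr.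
    exact: chart_inv_continuous.
  rewrite (_ : [set y | _] = closed_ball_ (fun z => `|z|) x r).
    apply: bounded_closed_compact; last exact: closed_closed_ball_.
    exists (`|x| + r); split; first exact: num_real.
    move=> M' xrM y /= xy; apply: le_trans (ltW xrM).
    rewrite -[y](subrK x) addrC (le_trans (ler_normD _ _))// lerD2l.
    by rewrite distrC.
  by apply/seteqP; split=> y; rewrite /closed_ball_ /= distrC.
apply/seteqP; split=> [p [dp pr]|_ [y /= yr <-]].
  by exists (c p) => //; exact: chart_funK.
have [p dp py] := cr y yr.
by rewrite -py chart_funK//; split=> //; rewrite py.
Qed.

(** The speed bound is available only while the curve is in the ball, which calls for a first-exit
    argument. Before the exit time the mean value inequality keeps the curve in a strictly smaller
    closed ball, so its limit at that time is still inside. *)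
Lemma chart_confinement (R : realType) (n : nat) (M : topologicalType)
    (c : chart R n M) (x : 'rV[R]_n) (r rho L a b : R) (gamma : R -> M) :
  hausdorff_space M -> (forall y, `|y - x| < r -> chart_cod c y) ->
  a <= b -> 0 <= L ->
  (forall t, t \in `[a, b] ->
    gamma s @[s --> within `[a, b] (nbhs t)] --> gamma t) ->
  (forall t, t \in `]a, b[ -> chart_dom c (gamma t) -> `|c (gamma t) - x| < r ->
    exists2 v, is_derive t 1 (c \o gamma) v & `|v| <= L) ->
  chart_dom c (gamma a) -> `|c (gamma a) - x| <= rho ->
  rho + L * (b - a) < r ->
  chart_dom c (gamma b) /\ `|c (gamma b) - x| <= rho + L * (b - a).
Proof.
move=> hM cr ab L0 gammac dgamma doma gammaa rhor.
pose B := [set p | chart_dom c p /\ `|c p - x| < r].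
have Bnbhs p : B p -> nbhs p B.
  move=> [dp pr]; apply: filterI.
    by apply: open_nbhs_nbhs; split=> //; exact: chart_dom_open.
  have cp : c q @[q --> p] --> c p by exact: chart_fun_continuous.
  have : `|c q - x| @[q --> p] --> `|c p - x|.
    by apply: cvg_norm; apply: cvgB => //; exact: cvg_cst.
  by move=> /(cvgr_lt _)/(_ _ pr).
have lip s : s \in `[a, b] -> (forall t, t \in `[a, s] -> B (gamma t)) ->
    `|c (gamma s) - x| <= rho + L * (s - a).
  rewrite in_itv /= => /andP[as_ sb] Bs.
  have : `|(c \o gamma) s - (c \o gamma) a| <= L * (s - a).
    apply: norm_mvt => // [t tas|].
      have [dt pt] := Bs t (subset_itv_oo_cc tas).
      have tab : t \in `]a, b[.
        by move: tas; rewrite !in_itv /= => /andP[->] /= /lt_le_trans; apply.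
      exact: dgamma.
    apply/subspace_continuousP => t tas.
    have [dt _] := Bs t tas.
    have tab : t \in `[a, b].
      move: (tas); rewrite /= !in_itv /= => /andP[->] /= /le_trans; exact.
    have gt : gamma u @[u --> within `[a, s] (nbhs t)] --> gamma t.
      apply: cvg_trans (gammac t tab); apply: cvg_app.
      apply: within_subset => u /=.
      by rewrite !in_itv /= => /andP[-> /le_trans]; exact.
    have := @cvg_comp _ _ _ gamma c _ _ _ gt; apply.
    exact: chart_fun_continuous.
  move=> /= h; rewrite -[_ - x](subrKA (c (gamma a))) addrC.
  by rewrite (le_trans (ler_normD _ _))// lerD.
have rho_le : rho <= rho + L * (b - a) by rewrite lerDl mulr_ge0// subr_ge0.
have Ba : B (gamma a).
  by split=> //; rewrite (le_lt_trans gammaa)// (le_lt_trans rho_le).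
suff Bab t : t \in `[a, b] -> B (gamma t).
  by split; [apply: (Bab b _).1|apply: lip => //]; rewrite in_itv /= lexx ab.
move=> tab; apply: contrapT => nBt.
pose E := [set t | t \in `[a, b] /\ ~ B (gamma t)].
have Et : E t by [].
(* [inf E] is the first time at which [gamma] is outside the ball. *)
have Elb : lbound E a by move=> s [/andP[]].
have hE : has_inf E by split; [exists t|exists a].
have aT : a <= inf E by apply: lb_le_inf => //; exists t.
have Tb : inf E <= b.
  by apply: le_trans (_ : t <= b); [apply: ge_inf; [exists a|]|case/andP: tab].
have BT s : s \in `[a, inf E[ -> B (gamma s).
  rewrite in_itv /= => /andP[as_ sT]; apply: contrapT => nB.
  have : inf E <= s.
    apply: ge_inf; first by exists a.
    by split=> //; rewrite in_itv /= as_ (le_trans (ltW sT)).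
  by rewrite leNgt sT.
have Tab : inf E \in `[a, b] by rewrite in_itv /= aT.
(* The infimum is attained: [B] is open, so [gamma (inf E)] in [B] would put all nearby times of the
   interval in [B], yet [E] has elements arbitrarily close to [inf E]. *)
have nBT : ~ B (gamma (inf E)).
  move=> /Bnbhs/(gammac _ Tab); rewrite /= => /nbhs_ballP[e /= e0 eB].
  have [s Es sT] := inf_adherent e0 hE; have [sab nBs] := Es.
  apply: nBs; apply: eB => //; rewrite /ball /= ltr_distlC.
  rewrite sT andbT (@lt_le_trans _ _ (inf E))//; first by rewrite ltrBlDr ltrDl.
  by apply: ge_inf; [exists a|].
(* Strictness lets [inf E] be approached from the left inside [[a, b]]. *)
have aT' : a < inf E.
  rewrite lt_neqAle aT andbT; apply/eqP => aE; apply: nBT; by rewrite -aE.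
pose K := [set p | chart_dom c p /\ `|c p - x| <= rho + L * (b - a)].
have Kcl : closed K.
  by apply: chart_closed_ball => // y yr; apply: cr; exact: le_lt_trans rhor.
(* Times just before [inf E] satisfy [lip], and the closed set [K] retains their limit, including
   its membership in the chart domain. *)
have [dT kT] : K (gamma (inf E)).
  apply: (@closed_cvg _ _ (at_left (inf E)) _ gamma K) => //.
  - near=> s.
    have as_ : a <= s by near: s; exact: nbhs_left_ge.
    have sT : s < inf E by [].
    have [ds _] : B (gamma s) by apply: BT; rewrite in_itv /= as_.
    split=> //; apply: le_trans (lip s _ _) _.
    + by rewrite in_itv /= as_ (le_trans (ltW sT)).
    + move=> u; rewrite in_itv /= => /andP[au us]; apply: BT.
      by rewrite in_itv /= au (le_lt_trans us).
    + by rewrite lerD2l ler_wpM2l// lerD2r (le_trans (ltW sT)).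
  - apply: cvg_trans (gammac _ Tab); apply: cvg_app => A /= wA.
    have {}wA : \forall s \near (inf E)^'-, `[a, b]%classic s -> A s.
      exact: (@cvg_within _ (nbhs (inf E)) _ _ _ wA).
    near=> s.
    have as_ : a <= s by near: s; exact: nbhs_left_ge.
    have sT : s < inf E by [].
    have : `[a, b]%classic s -> A s by near: s; exact: wA.
    by apply; rewrite /= in_itv /= as_ (le_trans (ltW sT)).
by apply: nBT; split=> //; exact: le_lt_trans rhor.
Unshelve. all: by end_near. Qed.

(** Induction on the exceptional times, for all intervals and initial radii at once: the interval is
    cut at [s], and the radius reached at [s] becomes the initial radius of the second half. *)
Lemma chart_confinement_finite (R : realType) (n : nat) (M : topologicalType)
    (c : chart R n M) (x : 'rV[R]_n) (r rho L a b : R) (gamma : R -> M)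
    (S : seq R) :
  hausdorff_space M -> (forall y, `|y - x| < r -> chart_cod c y) ->
  a <= b -> 0 <= L ->
  (forall t, t \in `[a, b] ->
    gamma s @[s --> within `[a, b] (nbhs t)] --> gamma t) ->
  (forall t, t \in `]a, b[ -> t \notin S ->
    chart_dom c (gamma t) -> `|c (gamma t) - x| < r ->
    exists2 v, is_derive t 1 (c \o gamma) v & `|v| <= L) ->
  chart_dom c (gamma a) -> `|c (gamma a) - x| <= rho ->
  rho + L * (b - a) < r ->
  chart_dom c (gamma b) /\ `|c (gamma b) - x| <= rho + L * (b - a).
Proof.
move=> hM cr + L0.
elim: S a b rho => [|s S IH] a b rho ab gammac dgamma doma gammaa rhor.
  apply: chart_confinement hM cr ab L0 gammac _ doma gammaa rhor => t /dgamma.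
  exact.
have restrict a' b' : a <= a' -> b' <= b -> forall t, t \in `[a', b'] ->
    gamma s @[s --> within `[a', b'] (nbhs t)] --> gamma t.
  move=> aa' bb' t tab.
  have sub : `[a', b']%classic `<=` `[a, b]%classic.
    by apply: subset_itv; rewrite bnd_simp.
  apply: cvg_trans (gammac t (sub _ tab)); apply: cvg_app.
  exact: within_subset.
have [|sab] := boolP (s \in `]a, b[); last first.
  apply: IH => // t tab tS; apply: dgamma => //; rewrite inE negb_or tS andbT.
  by apply: contraNneq sab => <-.
rewrite in_itv /= => /andP[as_ sb].
have Lsb : 0 <= L * (b - s) by rewrite mulr_ge0// subr_ge0 ltW.
have split_L : rho + L * (b - a) = rho + L * (s - a) + L * (b - s).
  by rewrite -addrA -mulrDr [s - a + _]addrC subrKA.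
have [doms gammas] : chart_dom c (gamma s) /\
    `|c (gamma s) - x| <= rho + L * (s - a).
  apply: IH => //; first exact: ltW.
  - exact: restrict (ltW sb).
  - move=> t; rewrite in_itv /= => /andP[at_ ts] tS; apply: dgamma.
      by rewrite in_itv /= at_ (lt_trans ts).
    by rewrite inE negb_or tS lt_eqF.
  - by rewrite (le_lt_trans _ rhor)// split_L lerDl.
rewrite split_L; apply: IH; rewrite -?split_L ?(ltW sb)//.
- exact: restrict (ltW as_) _.
- move=> t; rewrite in_itv /= => /andP[st tb] tS; apply: dgamma.
    by rewrite in_itv /= tb (lt_trans as_).
  by rewrite inE negb_or tS gt_eqF.
Qed.

(** * Velocities and piecewise smooth paths *)

(** The substitution [h = s - t] passes between the slopes in [is_velocity] and the difference
    quotients in [is_derive]. *)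
Lemma cvg_slope_is_derive (R : realType) (V : normedModType R) (f : R -> V)
    (t : R) (v : V) :
  (s - t)^-1 *: (f s - f t) @[s --> t^'] --> v <-> is_derive t 1 f v.
Proof.
have -> : ((s - t)^-1 *: (f s - f t) @[s --> t^'] --> v) =
    (h^-1 *: (f (h *: 1 + t) - f t) @[h --> 0^'] --> v).
  rewrite propeqE; split=> + A Av => /(_ A Av).
    rewrite /= /dnbhs /within /= => /nbhs_ballP[e /= e0 eA].
    apply/nbhs_ballP; exists e => //= h he h0.
    have := eA (h + t); rewrite /= addrK scaler1; apply.
      by move: he; rewrite /ball /= sub0r normrN opprD addrCA subrr addr0 normrN.
    by rewrite -subr_eq0 addrK.
  rewrite /= /dnbhs /within /= => /nbhs_ballP[e /= e0 eA].
  apply/nbhs_ballP; exists e => //= s hs st.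
  have := eA (s - t); rewrite /= scaler1 subrK; apply.
    by move: hs; rewrite /ball /= sub0r normrN distrC.
  by rewrite subr_eq0.
split=> [fv|[df <-] //].
by split; [apply/cvg_ex; exists v|exact: cvg_lim].
Qed.

Lemma is_velocity_interior (R : realType) (n : nat) (M : manifoldType R n)
    (D : set R) (gamma : R -> M) (t : R) (v : tangent (gamma t)) :
  nbhs t D -> is_velocity D gamma t v <->
  {for t, continuous gamma} /\ is_derive t 1 (chart_at (gamma t) \o gamma) v.
Proof.
move=> Dt; rewrite /is_velocity within_interior//.
have -> : within D t^' = t^'.
  rewrite eqEsubset; split; last exact: (@cvg_within _ t^' _ D).
  move=> A; rewrite /within /dnbhs /= => h.
  by apply: filterS2 Dt h => s Ds sA st; exact: sA.
by split=> -[gt d]; split=> //; apply/cvg_slope_is_derive.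
Qed.

Lemma smooth_within_cvg (R : realType) (V : normedModType R) (n : nat)
    (N : manifoldType R n) (A : set V) (F : V -> N) (x : V) :
  A x -> smooth_within A F x -> F y @[y --> within A (nbhs x)] --> F x.
Proof.
move=> Ax [F' /smooth_at_continuous F'c F'F].
rewrite -(nbhs_singleton F'F Ax).
apply: cvg_trans (cvg_within_filter A F'c).
by apply: near_eq_cvg; apply: filterS F'F => y /=.
Qed.

Lemma partition_cover (R : realType) (k : nat) (t : nat -> R) (s : R) :
  (0 < k)%N -> t 0%N <= s <= t k ->
  exists2 i, (i < k)%N & s \in `[t i, t i.+1].
Proof.
case: k => // k _; elim: k => [|k IH] /andP[t0s st].
  by exists 0%N => //; rewrite in_itv /= t0s.
have [sk|ks] := leP s (t k.+1).
  by have [|i ik si] := IH; [rewrite t0s|exists i => //; exact: ltnW].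
by exists k.+1 => //; rewrite in_itv /= (ltW ks).
Qed.

Lemma path_partition_gt0 (R : realType) (k : nat) (t : nat -> R) :
  t 0%N = 0 -> t k = 1 -> (0 < k)%N.
Proof. by case: k => // -> /eqP; rewrite eq_sym oner_eq0. Qed.

(** Each piece of the partition is closed: either it contains [s], and smoothness on it applies, or
    it misses a neighbourhood of [s]. Finitely many such neighbourhoods are intersected. *)
Lemma path_continuous (R : realType) (n : nat) (M : manifoldType R n)
    (gamma : R -> M) (s : R) :
  is_path gamma -> s \in `[0, 1] ->
  gamma u @[u --> within `[0, 1] (nbhs s)] --> gamma s.
Proof.
move=> [k [t [t0 tk tP]]] s01 W Wg.
have near_piece (i : 'I_k) :
    \forall u \near s, u \in `[t i, t i.+1] -> W (gamma u).
  have [_ /(_ s) gi] := tP i (ltn_ord i).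
  have [si|si] := pselect (`[t i, t i.+1]%classic s).
    exact: (smooth_within_cvg si (gi si)) W Wg.
  have : nbhs s (~` `[t i, t i.+1]%classic).
    apply: open_nbhs_nbhs; split=> //.
    by apply: closed_openC; exact: interval_closed.
  by move=> sC; apply: filterS sC => u.
have all_pieces := @filter_forall _ _ _ _ _ near_piece.
suff : \forall u \near s, u \in `[0, 1] -> W (gamma u) by [].
apply: filterS (all_pieces _) => u /= uW u01.
have [|i ik ui] := @partition_cover R k t u (path_partition_gt0 t0 tk).
  by rewrite t0 tk; move: u01; rewrite in_itv.
exact: uW (Ordinal ik) ui.
Qed.

Lemma nbhs_itvoo (R : realType) (a b s : R) :
  s \in `]a, b[ -> nbhs s `[a, b]%classic.
Proof.
move=> sab; have sN := near_in_itvoo sab.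
by apply: filterS (sN) => u /=; exact: subset_itv_oo_cc.
Qed.

(** [S] lists the partition points; any other time is interior to a smooth piece. *)
Lemma path_has_velocity (R : realType) (n : nat) (M : manifoldType R n)
    (gamma : R -> M) :
  is_path gamma -> exists S : seq R, forall s, s \in `]0, 1[ -> s \notin S ->
    has_velocity `[0, 1] gamma s.
Proof.
move=> [k [t [t0 tk tP]]]; exists [seq t i | i <- iota 0 k.+1] => s s01 sS.
have sN i : (i <= k)%N -> t i != s.
  move=> ik; apply: contraNneq sS => <-; apply: map_f.
  by rewrite mem_iota add0n ltnS.
have [|i ik] := @partition_cover R k t s (path_partition_gt0 t0 tk).
  by rewrite t0 tk; move: s01; rewrite in_itv => /andP[/ltW -> /ltW ->].
rewrite in_itv /= => /andP[ti_s s_ti].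
have si : `]t i, t i.+1[%classic s.
  rewrite /= in_itv /= !lt_neqAle ti_s s_ti (sN i (ltnW ik)) /= andbT.
  by rewrite eq_sym; exact: sN.
have [_ /(_ s (subset_itv_oo_cc si)) gs] := tP i ik.
have [gc /nbhs_singleton gd _] := smooth_within_interior (nbhs_itvoo si) gs.
exists ('D_1 (chart_at (gamma s) \o gamma) s).
apply/is_velocity_interior; first exact: nbhs_itvoo.
by split=> //; apply/derivableP/derivable1_diffP.
Qed.

(** * Left translations and the Maurer-Cartan form *)

Lemma is_derive_comp_diff (R : realType) (V W : normedModType R) (z : R -> V)
    (f : V -> W) (t : R) (w : V) :
  is_derive t 1 z w -> differentiable f (z t) ->
  is_derive t 1 (f \o z) ('d f (z t) w).
Proof.
move=> [/derivable1_diffP dz <-] df.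
have dfz : differentiable (f \o z) t by exact: differentiable_comp.
split; first exact/derivable1_diffP.
by rewrite deriveE// diff_comp//= deriveE.
Qed.

(** Treating both factors as variables makes the differentials of left translations depend
    continuously on the translating element, which yields uniform bounds near 1. *)
Lemma mulg_chart_regular (R : realType) (n : nat) (G : lieGroupType R n)
    (p q : G) :
  let F (z : 'rV[R]_n * 'rV[R]_n) :=
    (chart_inv (chart_at p) z.1 * chart_inv (chart_at q) z.2)%g in
  let f := chart_at (p * q)%g \o F in
  let z0 := (chart_at p p, chart_at q q) in
  [/\ F z @[z --> z0] --> (p * q)%g,
      \forall z \near z0, differentiable f z &
      forall v, 'd f z v @[z --> z0] --> 'd f z0 v].
Proof.
move=> F f z0.
have Fz0 : F z0 = (p * q)%g by rewrite /F /= !chart_funK//; exact: chart_at_dom.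
have sF : smooth_within ((chart_inv (chart_at p) @^-1` [set: G]) `*`
    (chart_inv (chart_at q) @^-1` [set: G])) F z0 by exact: mulg_smooth.
have [|Fc df dfc] := smooth_within_interior _ sF.
  by apply: filterE => z; split.
rewrite Fz0 in df dfc; split=> //.
by rewrite -Fz0; exact: Fc.
Qed.

Lemma differentiable_pairr (R : realType) (U V : normedModType R) (a : U)
    (b : V) :
  differentiable (fun y : V => (a, y)) b /\
  forall v, 'd (fun y : V => (a, y)) b v = (0, v).
Proof.
have da : differentiable (fun _ : V => a) b := differentiable_cst a b.
have db : differentiable (fun y : V => y) b by exact: ex_diff.
split=> [|v]; first exact: differentiable_pair.
rewrite diff_pair//=; congr (_, _); last by rewrite (diff_val (f := id)).
by rewrite (diff_cst a b).
Qed.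

Lemma mulg_left_continuous (R : realType) (n : nat) (G : lieGroupType R n)
    (a q : G) : (a * y)%g @[y --> q] --> (a * q)%g.
Proof.
have [Fc _ _] := mulg_chart_regular a q.
have pairc : (chart_at a a, chart_at q y) @[y --> q] -->
    (chart_at a a, chart_at q q).
  have qc : chart_at q y @[y --> q] --> chart_at q q.
    exact/chart_fun_continuous/chart_at_dom.
  exact: (cvg_pair (cvg_cst (chart_at a a)) qc).
apply: cvg_trans (cvg_comp _ _ pairc Fc).
have domq : nbhs q (chart_dom (chart_at q)).
  by apply: open_nbhs_nbhs; split; [exact: chart_dom_open|exact: chart_at_dom].
apply: near_eq_cvg; apply: filterS domq => y yq /=.
by rewrite !chart_funK//; exact: chart_at_dom.
Qed.

Lemma mulg_left_differentiable (R : realType) (n : nat) (G : lieGroupType R n)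
    (a q : G) :
  differentiable (chart_at (a * q)%g \o (fun y => (a * y)%g) \o
    chart_inv (chart_at q)) (chart_at q q).
Proof.
have [_ + _] := mulg_chart_regular a q.
set f := _ \o _ => /nbhs_singleton df.
have [dp _] := differentiable_pairr (chart_at a a) (chart_at q q).
suff -> : chart_at (a * q)%g \o (fun y => (a * y)%g) \o
    chart_inv (chart_at q) = f \o (fun y => (chart_at a a, y)).
  exact: differentiable_comp dp df.
by apply/funext => b; rewrite /f /= chart_funK//; exact: chart_at_dom.
Qed.

(** This is the chain rule in the chart at [gamma t]; continuity of [gamma] keeps it in the chart
    domain near [t], where [chart_inv] cancels the chart. *)
Lemma is_derive_mulg_left (R : realType) (n : nat) (G : lieGroupType R n)
    (a : G) (gamma : R -> G) (t : R) (w : tangent (gamma t)) :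
  {for t, continuous gamma} ->
  is_derive t 1 (chart_at (gamma t) \o gamma) w ->
  is_derive t 1 (chart_at (a * gamma t)%g \o (fun s => (a * gamma s)%g))
    (mderiv (fun y => (a * y)%g) (gamma t) w).
Proof.
move=> gc dw.
have := is_derive_comp_diff dw (mulg_left_differentiable a (gamma t)).
apply: near_eq_is_derive.
have domg : nbhs (gamma t) (chart_dom (chart_at (gamma t))).
  by apply: open_nbhs_nbhs; split; [exact: chart_dom_open|exact: chart_at_dom].
have gcdom : \forall s \near t, chart_dom (chart_at (gamma t)) (gamma s).
  exact: gc.
by apply: filterS gcdom => s ds /=; rewrite chart_funK.
Qed.

(* With [p = gamma t], write [gamma s = p * (p^-1 * gamma s)]: the velocity of
   [p^-1 * gamma] at [t] is the Maurer-Cartan form, and the differential of left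
   translation by [p] at 1 is bounded for [p] near 1. *)
Lemma maurer_cartan_bound (R : realType) (n : nat) (G : lieGroupType R n) :
  exists2 K : R, 0 < K & \forall p \near (1%g : G),
    forall (gamma : R -> G) (t : R) (w : tangent (gamma t)), gamma t = p ->
    {for t, continuous gamma} ->
    is_derive t 1 (chart_at (gamma t) \o gamma) w ->
    exists2 v, is_derive t 1 (chart_at (1%g : G) \o gamma) v &
      `|v| <= K * `|maurer_cartan (gamma t) w|.
Proof.
pose phi := chart_at (1%g : G).
have dom1 : chart_dom phi 1%g by exact: chart_at_dom.
have domphi : nbhs (1%g : G) (chart_dom phi).
  by apply: open_nbhs_nbhs; split=> //; exact: chart_dom_open.
have [_] := mulg_chart_regular (1%g : G) 1%g.
rewrite [X in chart_at X \o _]mulg1 -/phi.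
set f := phi \o _; set z0 := (_, _) => df dfc.
(* Only directions in the second factor matter, since the left factor is held fixed. The margin 1 in
   [k] makes the bound persist near [z0]. *)
pose e (i : 'I_n) : 'rV[R]_n * 'rV[R]_n := (0, delta_mx 0 i).
pose k i := `|'d f z0 (e i)| + 1.
have dfk i : \forall z \near z0, `|'d f z (e i)| <= k i.
  have dfn : `|'d f z (e i)| @[z --> z0] --> `|'d f z0 (e i)|.
    exact: cvg_norm (dfc (e i)).
  by apply: (cvgr_le _ dfn); rewrite ltrDl.
have {}dfk := filter_forall _ dfk.
have pairc : (phi p, phi 1%g) @[p --> (1%g : G)] --> z0.
  have phic : phi p @[p --> (1%g : G)] --> phi 1%g.
    exact: chart_fun_continuous.
  exact: (cvg_pair phic (cvg_cst (phi 1%g))).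
(* The sum bounds the operator norm for the sup norm; the added 1 keeps the constant positive even
   when [n = 0]. *)
exists (1 + \sum_i k i).
  by rewrite ltr_wpDr// sumr_ge0// => i _; rewrite addr_ge0.
have {}df : \forall p \near (1%g : G), differentiable f (phi p, phi 1%g).
  exact: pairc _ df.
have {}dfk : \forall p \near (1%g : G), forall i,
    `|'d f (phi p, phi 1%g) (e i)| <= k i.
  exact: pairc _ (dfk _).
near=> p => gamma t w gp gc dw.
have domp : chart_dom phi p by near: p.
have dfp : differentiable f (phi p, phi 1%g) by near: p.
have dfkp : forall i, `|'d f (phi p, phi 1%g) (e i)| <= k i by near: p.
have [dpair pairE] := differentiable_pairr (phi p) (phi 1%g).
(* [g] is left translation by [p] in the coordinates [phi]. *)
pose g := f \o (fun b => (phi p, b)).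
have dg : differentiable g (phi 1%g) by exact: differentiable_comp.
have := is_derive_mulg_left (gamma t)^-1%g gc dw.
rewrite mulVg -/(maurer_cartan (gamma t) w) -/phi => dY.
set Y := maurer_cartan (gamma t) w in dY *.
exists ('d g (phi 1%g) Y).
  have y1 : (phi \o (fun s => (gamma t)^-1 * gamma s)%g) t = phi 1%g.
    by rewrite /= mulVg.
  have := is_derive_comp_diff dY; rewrite y1 => /(_ _ g dg).
  apply: near_eq_is_derive.
  have c1 : ((gamma t)^-1 * gamma s)%g @[s --> t] --> (1%g : G).
    rewrite -(mulVg (gamma t)); apply: cvg_comp gc _.
    exact: mulg_left_continuous.
  have c1dom : \forall s \near t, chart_dom phi ((gamma t)^-1 * gamma s)%g.
    exact: c1.
  apply: filterS c1dom => s ds /=.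
  by rewrite /g /f /= !chart_funK// -gp mulVKg.
have Y_sum : 'd g (phi 1%g) Y =
    \sum_i (Y : 'rV[R]_n) 0 i *: 'd g (phi 1%g) (delta_mx 0 i).
  rewrite [in LHS](row_sum_delta (Y : 'rV[R]_n)) linear_sum.
  by apply: eq_bigr => i _; rewrite linearZ.
rewrite Y_sum (le_trans (ler_norm_sum _ _ _))// mulrDl mul1r.
rewrite (@le_trans _ _ ((\sum_i k i) * `|Y|)) ?lerDr//.
rewrite mulr_suml; apply: ler_sum => i _.
rewrite normrZ mulrC ler_pM//.
  have -> : 'd g (phi 1%g) (delta_mx 0 i) = 'd f (phi p, phi 1%g) (e i).
    by rewrite /g diff_comp//= pairE.
  exact: dfkp.
rewrite [leRHS]/Num.Def.normr/= mx_normrE.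
exact: (le_bigmax _ (fun ij => `|(Y : 'rV[R]_n) ij.1 ij.2|) (0, i)).
Unshelve. all: by end_near. Qed.

(** * Norms on the Lie algebra and the path distance *)

(** The quadratic form of [g] is continuous and positive on the compact unit sphere of the sup norm,
    so it has a positive minimum there; homogeneity extends the estimate to all vectors. *)
Lemma norm_le_lie_norm (R : realType) (n : nat) (G : lieGroupType R n)
    (g : {dot (lie_algebra G) for idfun}) :
  exists2 c : R, 0 < c & forall Y : lie_algebra G, `|Y| <= c * lie_norm g Y.
Proof.
pose q (Y : 'rV[R]_n) : R := g Y Y.
(* [g] is given algebraically; its expansion in the standard basis reduces continuity to that of the
   coordinates. *)
have qE Y : q Y = \sum_i Y 0 i * \sum_j Y 0 j * g (delta_mx 0 i) (delta_mx 0 j).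
  rewrite /q [in X in g X _](row_sum_delta Y) linear_sumlz.
  apply: eq_bigr => i _; rewrite linearZl_LR; congr (_ * _).
  rewrite [in LHS](row_sum_delta Y) linear_sumr.
  by apply: eq_bigr => j _; rewrite linearZr_LR.
have cM (f h : 'rV[R]_n -> R) : continuous f -> continuous h ->
    continuous (fun Y => f Y * h Y).
  by move=> cf ch Y; exact: (cvgM (cf Y) (ch Y)).
have qc : continuous q.
  rewrite (_ : q = fun Y => \sum_i Y 0 i * \sum_j Y 0 j *
      g (delta_mx 0 i) (delta_mx 0 j)); last exact/funext.
  apply: continuous_big => [|i _]; first exact: add_continuous.
  apply: (cM); first exact: coord_continuous.
  apply: continuous_big => [|j _]; first exact: add_continuous.
  by apply: (cM); [exact: coord_continuous|exact: cst_continuous].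
have qZ (a : R) Y : q (a *: Y) = a ^+ 2 * q Y.
  by rewrite /q linearZl_LR linearZr_LR /= mulrA.
have q_gt0 Y : Y != 0 -> 0 < q Y by exact: neq0_dnorm_gt0.
pose S := [set Y : 'rV[R]_n | `|Y| = 1].
have S1 (Y : 'rV[R]_n) : Y != 0 -> S (`|Y|^-1 *: Y).
  by move=> Y0; rewrite /S /= normrZ normfV normr_id mulVf// normr_eq0.
(* An empty sphere means that every vector is 0, and then any positive constant works. *)
have [[Y0 SY0]|S0] := pselect (S !=set0); last first.
  exists 1 => // Y; have [->|/S1 YS] := eqVneq (Y : 'rV[R]_n) 0.
    by rewrite normr0 mul1r sqrtr_ge0.
  by exfalso; apply: S0; eexists; exact: YS.
have Sc : compact S.
  apply: bounded_closed_compact.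
    exists 1; split; first exact: num_real.
    by move=> r r1 Y /= ->; exact: ltW.
  rewrite (_ : S = (fun Y => `|Y|) @^-1` [set 1]) //.
  apply: closed_comp; last exact: closed_eq.
  by move=> Y _; exact: norm_continuous.
have [|Z SZ Zmin] := @EVT_min_rV R n q S _ Sc (continuous_subspaceT qc).
  by exists Y0.
have Z0 : Z != 0 by rewrite -normr_eq0 (set_mem SZ) oner_eq0.
have qZ0 : 0 < q Z := q_gt0 _ Z0.
exists (Num.sqrt (q Z))^-1; first by rewrite invr_gt0 sqrtr_gt0.
move=> Y; rewrite mulrC ler_pdivlMr ?sqrtr_gt0//.
have [->|Yn0] := eqVneq (Y : 'rV[R]_n) 0.
  by rewrite normr0 mul0r sqrtr_ge0.
rewrite -[`|Y|]ger0_norm// -sqrtr_sqr -sqrtrM ?sqr_ge0// ler_wsqrtr//.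
have YE : (Y : 'rV[R]_n) = `|Y| *: (`|Y|^-1 *: (Y : 'rV[R]_n)).
  by rewrite scalerA mulfV ?scale1r// normr_eq0.
rewrite -[leRHS]/(q Y) [in leRHS]YE qZ ler_wpM2l ?sqr_ge0//.
exact/Zmin/mem_set/S1.
Qed.

Lemma velocity_cst (R : realType) (n : nat) (M : manifoldType R n) (e : M)
    (D : set R) (t : R) : nbhs t D ->
  is_velocity D (fun=> e) t 0 /\ velocity D (fun=> e) t = 0.
Proof.
move=> Dt.
have v0 : is_velocity D (fun=> e) t 0.
  apply/is_velocity_interior => //; split; first exact: cst_continuous.
  exact: is_derive_cst.
split=> //.
(* [xget] selects some velocity, as 0 is one; uniqueness of derivatives identifies the two. *)
have : is_velocity D (fun=> e) t (velocity D (fun=> e) t).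
  by apply: xgetPex; exists 0.
move=> /(is_velocity_interior _ Dt)[_ [_ <-]].
exact: derive_cst.
Qed.

(** The first summand of [path_dist] is nonnegative because lengths are, and [t] is among the times
    of the second supremum, where the constant path contributes 0. *)
Lemma velocity_le_path_dist (R : realType) (n m l : nat)
    (G : lieGroupType R n) (H : closedSubgroup G)
    (M : manifoldType R m) (P : manifoldType R l)
    (C : cartanGeometry H M P) (e : P) (g : {dot (lie_algebra G) for idfun})
    (gamma : R -> P) (t : R) :
  t \in `]0, 1[ -> has_velocity `[0, 1] gamma t ->
  ((lie_norm g (omega C (gamma t) (velocity `[0, 1] gamma t)))%:E <=
    path_dist C g gamma (fun=> e))%E.
Proof.
move=> t01 gv; have tI : `[0, 1]%classic t by exact: subset_itv_oo_cc t01.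
have [cv cv0] := velocity_cst e (nbhs_itvoo t01).
rewrite /path_dist; apply: lee_paddl.
  apply: (@le_trans _ _ (riemannian_dist C g (gamma t) e)).
    apply: le_ereal_inf_tmp => _ [c _ <-].
    by apply: integral_ge0 => s _; rewrite lee_fin sqrtr_ge0.
  by apply: ereal_sup_ubound; exists t.
apply: ereal_sup_ubound; exists t; first by split=> //; exists 0.
by rewrite cv0 linear0 subr0.
Qed.

(** * Choice of constants and convergence of the end points *)

Theorem lemma3p4 (R : realType) (n m l : nat)
    (G : lieGroupType R n) (H : closedSubgroup G)
    (GH_connected : connected [set: coset_space H])
    (M : manifoldType R m) (P : manifoldType R l)
    (C : cartanGeometry H M P) (e : P)
    (g : {dot (lie_algebra G) for idfun})
    (gamma : nat -> R -> P) (gammaG : nat -> R -> G)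
    (gamma_path : forall k, path_from e (gamma k))
    (gamma_cvg : path_dist C g (gamma k) (fun=> e) @[k --> \oo] --> (0 : \bar R))
    (gammaG_dev : forall k, is_development C (gamma k) (gammaG k)) :
  gammaG k 1 @[k --> \oo] --> (1%g : G).
Proof.
have [K K0 MC_le] := maurer_cartan_bound G.
have [c c0 norm_le] := norm_le_lie_norm g.
pose phi := chart_at (1%g : G).
have dom1 : chart_dom phi 1%g by exact: chart_at_dom.
have inv_phi : chart_inv phi y @[y --> phi 1%g] --> (1%g : G).
  rewrite -[X in _ --> X](chart_funK dom1).
  exact/chart_inv_continuous/chart_cod_fun.
move=> W W1.
(* These coordinates allow the Maurer-Cartan estimate and lie over the target neighbourhood [W];
   they fill a ball around [phi 1]. *)
pose good y := [/\ chart_cod phi y,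
  forall (c : R -> G) (t : R) (w : tangent (c t)), c t = chart_inv phi y ->
    {for t, continuous c} -> is_derive t 1 (chart_at (c t) \o c) w ->
    exists2 v, is_derive t 1 (phi \o c) v &
      `|v| <= K * `|maurer_cartan (c t) w|
  & W (chart_inv phi y)].
have good_near : \forall y \near phi 1%g, good y.
  have cod1 : nbhs (phi 1%g) (chart_cod phi).
    apply: open_nbhs_nbhs; split; first exact: chart_cod_open.
    exact: chart_cod_fun.
  have MC_near := inv_phi _ MC_le; have W_near := inv_phi _ W1.
  by near=> y; split; near: y.
have [r /= r0 r_good] := (nbhs_ballP _ _).1 good_near.
have {}r_good y : `|y - phi 1%g| < r -> good y.
  by move=> yr; apply: r_good; rewrite -ball_normE /= distrC.
(* An [omega]-speed below [eps] gives coordinate speed at most [K * c * eps = r / 2], so in unit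
   time the curve moves at most half the radius. *)
pose eps := r / 2 / (K * c).
have eps0 : 0 < eps by rewrite !divr_gt0// mulr_gt0.
have lt_eps : nbhs (0 : \bar R) [set y | (y < eps%:E)%E].
  apply: open_nbhs_nbhs; split; last by rewrite /= lte_fin.
  exact: open_ereal_lt_ereal.
have dist_lt : \forall k \near \oo,
    (path_dist C g (gamma k) (fun=> e) < eps%:E)%E by exact: gamma_cvg lt_eps.
suff : \forall k \near \oo, W (gammaG k 1) by [].
apply: filterS dist_lt => k dist_k.
have [[pathG gammaG0] dev] := gammaG_dev k.
have [S SP] := path_has_velocity (gamma_path k).1.
have [SG SGP] := path_has_velocity pathG.
have Lr : K * c * eps = r / 2.
  by rewrite /eps mulrC divfK// mulf_neq0 ?gt_eqF.
have L_lt : 0 + K * c * eps * (1 - 0) < r.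
  by rewrite add0r subr0 mulr1 Lr ltr_pdivrMr// ltr_pMr// ltr1n.
(* The break points of [gamma k] and of its development may differ; both lists are excluded because
   the two forms are compared only where both velocities exist. *)
have := @chart_confinement_finite R n G phi (phi 1%g) r 0 (K * c * eps) 0 1
  (gammaG k) (S ++ SG) manifold_hausdorff _ ler01 _ _ _ _ _ L_lt.
case.
- by move=> y /r_good[].
- by rewrite Lr divr_ge0// ltW.
- by move=> t; exact: path_continuous.
- move=> t t01; rewrite mem_cat negb_or.
  move=> /andP[/(SP t t01) gv /(SGP t t01)[w wv]].
  move=> domt /r_good[_ + _]; rewrite chart_funK// => bound.
  have [cG dG] := (is_velocity_interior _ (nbhs_itvoo t01)).1 wv.
  have [v dv vle] := bound _ _ _ erefl cG dG.
  (* The development condition turns the Maurer-Cartan norm into that of [omega] on the velocity of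
     [gamma k], which is at most [c] times its [lie_norm], hence at most [c * eps]. *)
  exists v => //; apply: le_trans vle _; rewrite -mulrA ler_pM2l//.
  have gvel : is_velocity `[0, 1] (gamma k) t (velocity `[0, 1] (gamma k) t).
    exact: xgetPex gv.
  rewrite -(dev t (subset_itv_oo_cc t01) _ _ gvel wv).
  apply: le_trans (norm_le _) _; rewrite ler_pM2l//.
  rewrite -lee_fin (le_trans (velocity_le_path_dist C e g t01 gv))//.
  exact: ltW.
- by rewrite gammaG0.
- by rewrite gammaG0 subrr normr0.
move=> domG normG; rewrite -(chart_funK domG).
by have [] := r_good _ (le_lt_trans normG L_lt).
Unshelve. all: by end_near. Qed.
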